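(* Let $c_{ij}=c_{ji}$, $c'=(c_1,\dots,c_n)$ and $c$ be real constants, let $h(x)=c_{ij}x^ix^j+\langle c',x\rangle+c$, and let $U\subset\mathbb{R}^n$ be an open set on which $h\neq0$ and on which the constants are appropriate, i.e. the expression under the square root below is strictly positive for all $x\in U$ and $y\in\mathbb{R}^n\setminus\{0\}$ and $F$ is a Finsler metric on $U$. Then $$F(x,y)=\sqrt{\frac{4h(x)\,c_{ij}y^iy^j-4(c_{ij}x^iy^j)^2-4\langle c',y\rangle\, c_{ij}x^iy^j-\langle c',y\rangle^2}{(2h(x))^2}}$$ is a projectively flat Finsler metric on $U$.
   Context: Summation over repeated indices is understood; $\langle\cdot,\cdot\rangle$ is the Euclidean inner product. A Finsler metric on an open set $U\subset\mathbb{R}^n$ is a map $F:U\times\mathbb{R}^n\to\mathbb{R}$, smooth and strictly positive for $y\ne0$, zero at $y=0$, positively $1$-homogeneous in $y$, such that the matrix $\left(\frac{\partial^2E}{\partial y^i\partial y^j}\right)$, $E=\frac12F^2$, has rank $n$ for $y\neq0$. It is projectively flat if all its geodesics are straight lines in $U$ (as point sets), equivalently $y^j\frac{\partial^2F}{\partial y^i\partial x^j}-\frac{\partial F}{\partial x^i}=0$ for all $i$ and all $y\neq 0$. *)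

(* Defs.v *)
From HB Require Import structures.
From mathcomp Require Import all_boot all_order all_algebra.
From mathcomp Require Import all_classical all_reals all_analysis.

Set Implicit Arguments.
Unset Strict Implicit.
Unset Printing Implicit Defensive.

Import Order.TTheory GRing.Theory Num.Theory.
Import numFieldNormedType.Exports.

Local Open Scope classical_set_scope.
Local Open Scope ring_scope.

Section Smooth.
Variables (R : realType) (V : normedModType R).

Definition iter_deriv (f : V -> R) (vs : seq V) : V -> R :=
  foldr (fun v g => 'D_v g) f vs.

(* For V finite-dimensional and O open this is the usual notion of a C^oo
   function on O: partial derivatives of all orders exist and are
   continuous. *)
Definition smooth_on (O : set V) (f : V -> R) : Prop :=
  forall (vs : seq V) (p : V), O p ->
    {for p, continuous (iter_deriv f vs)} /\
    (forall v, derivable (iter_deriv f vs) p v).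

End Smooth.

Section Finsler.
Variables (R : realType) (n : nat).
Local Notation vec := 'rV[R]_n.

Definition partial (i : 'I_n) (f : vec -> R) : vec -> R :=
  'D_(delta_mx 0 i) f.

Definition energy (F : vec -> vec -> R) (x y : vec) : R := 2^-1 * F x y ^+ 2.

Definition energy_hessian (F : vec -> vec -> R) (x y : vec) : 'M[R]_n :=
  \matrix_(i, j) partial i (partial j (energy F x)) y.

(* A metric on U is given by a total function F x y, of which only the values
   at x in U are constrained. *)
Record finsler_metric (U : set vec) (F : vec -> vec -> R) : Prop :=
  FinslerMetric {
    finsler_smooth :
      smooth_on [set p : vec * vec | U p.1 /\ p.2 != 0]
        (fun p => F p.1 p.2);
    finsler_gt0 : forall x y, U x -> y != 0 -> 0 < F x y;
    finsler_0 : forall x, U x -> F x 0 = 0;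
    finsler_homogeneous : forall x y (a : R), U x -> 0 < a ->
      F x (a *: y) = a * F x y;
    finsler_rank : forall x y, U x -> y != 0 ->
      \rank (energy_hessian F x y) = n }.

(* The last field is the Euler-Lagrange equation of the energy E,
     d/dt (dE/dy^i (g, g')) = dE/dx^i (g, g'). *)
Record geodesic (U : set vec) (F : vec -> vec -> R) (I : set R)
    (g : R -> vec) : Prop := Geodesic {
  geodesic_open : open I;
  geodesic_interval : is_interval I;
  geodesic_nonempty : I !=set0;
  geodesic_in : forall t, I t -> U (g t);
  geodesic_derivable : forall t, I t -> derivable g t 1;
  geodesic_derivable2 : forall t, I t -> derivable (derive1 g) t 1;
  geodesic_regular : forall t, I t -> derive1 g t != 0;
  geodesic_EL : forall t (i : 'I_n), I t ->
    is_derive t 1 (fun s => partial i (energy F (g s)) (derive1 g s))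
      (partial i (fun x => energy F x (derive1 g t)) (g t)) }.

(* A nonempty interval of an affine line; it cannot reduce to a point when L is
   the trace of a geodesic, which is a regular curve. *)
Definition straight (L : set vec) : Prop :=
  exists (a v : vec) (J : set R),
    [/\ v != 0, is_interval J, J !=set0 & L = [set a + s *: v | s in J]].

Definition projectively_flat (U : set vec) (F : vec -> vec -> R) : Prop :=
  forall (I : set R) (g : R -> vec), geodesic U F I g -> straight (g @` I).

Definition dot (u v : vec) : R := \sum_i u 0 i * v 0 i.

Definition bilin (C : 'M[R]_n) (u v : vec) : R :=
  \sum_i \sum_j C i j * u 0 i * v 0 j.

Definition hfun (C : 'M[R]_n) (c' : vec) (c : R) (x : vec) : R :=
  bilin C x x + dot c' x + c.

Definition radicand (C : 'M[R]_n) (c' : vec) (c : R) (x y : vec) : R :=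
  (4 * hfun C c' c x * bilin C y y - 4 * bilin C x y ^+ 2
   - 4 * dot c' y * bilin C x y - dot c' y ^+ 2) / (2 * hfun C c' c x) ^+ 2.

Definition quadratic_metric (C : 'M[R]_n) (c' : vec) (c : R) (x y : vec) : R :=
  Num.sqrt (radicand C c' c x y).

End Finsler.

(* Main.v *)
Require Import Defs.
From mathcomp Require Import all_boot all_order all_algebra.
From mathcomp Require Import all_classical all_reals all_analysis.
From mathcomp Require Import ring.
Import Order.TTheory GRing.Theory Num.Theory.
Import numFieldNormedType.Exports.
Local Open Scope classical_set_scope.
Local Open Scope ring_scope.

(** The numerator of the radicand is [4 h(x) C(y, y) - (dh_x y)^2], where
    [dh_x y = 2 C(x, y) + <c', y>] is the differential of [h]. So the metric is
    Riemannian: [F(x, y)^2 = A_x(y, y)] for the symmetric bilinear form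
      [A_x(y, w) = C(y, w) / h(x) - (dh_x y) (dh_x w) / (4 h(x)^2)],
    which is positive definite because the radicand is positive.

    Along a geodesic [g] the Euler-Lagrange equation equates the derivative of
    the momentum [A_g(g', e)] with half the derivative of [A_x(g', g')] in [x]
    along [e]. The Hessian of [h] is the constant form [2 C], so both sides
    involve only [C], [dh] and [h], and the equation simplifies to
      [A_g(g'' - ((h o g)' / (h o g)) g', e) = 0] for every [e].
    Definiteness gives [g'' = ((h o g)' / (h o g)) g'] (lemma
    [geodesic_acceleration]), that is, [g' / (h o g)] has zero derivative. The
    velocity is then [h] times a constant vector, and a regular curve on an
    interval with velocity of fixed direction traces an interval of a line
    (lemma [straight_of_direction]). *)

Set Implicit Arguments.
Unset Strict Implicit.

(** * Differentiation along a vector *)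

Section Calculus.
Context {R : realType} {V : normedModType R}.
Implicit Types (p v : V).

Lemma is_derive_coordP m n (X : V -> 'M[R]_(m, n)) p v (X' : 'M[R]_(m, n)) :
  is_derive p v X X' <->
  forall i j, is_derive p v (fun q => X q i j) (X' i j).
Proof.
split=> [dX i j|dX].
  have dXi : derivable X p v by exact: ex_derive.
  apply: DeriveDef; first by move/derivable_mxP: (dXi); exact.
  by rewrite -(@derive_val _ _ _ _ _ _ _ dX) derive_mx// mxE.
have dXi : derivable X p v by apply/derivable_mxP => i j; exact: ex_derive.
apply: DeriveDef => //; rewrite derive_mx//.
by apply/matrixP => i j; rewrite mxE derive_val.
Qed.

Lemma is_derive_mul (f g : V -> R) p v f' g' :
  is_derive p v f f' -> is_derive p v g g' ->
  is_derive p v (fun q => f q * g q) (f' * g p + f p * g').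
Proof.
move=> df dg; apply: (is_derive_eq (is_deriveM df dg)).
by rewrite /GRing.scale/=; ring.
Qed.

Lemma is_derive_div (f g : V -> R) p v f' g' :
  is_derive p v f f' -> is_derive p v g g' -> g p != 0 ->
  is_derive p v (fun q => f q / g q) ((f' * g p - f p * g') / g p ^+ 2).
Proof.
move=> df dg g0.
have dV : is_derive p v (fun q => (g q)^-1) (- (g p) ^- 2 * g').
  apply: DeriveDef; first by apply: derivableV => //; exact: ex_derive.
  by rewrite deriveV//; congr (_ * _); exact: derive_val.
by apply: (is_derive_eq (is_derive_mul df dV)); field.
Qed.

Lemma is_derive_sumr n (f : 'I_n -> V -> R) p v (f' : 'I_n -> R) :
  (forall i, is_derive p v (f i) (f' i)) ->
  is_derive p v (fun q => \sum_i f i q) (\sum_i f' i).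
Proof.
move=> df; have -> : (fun q => \sum_i f i q) = \sum_i f i.
  by apply/funext => q; rewrite fct_sumE.
exact: is_derive_sum.
Qed.

End Calculus.

(** * Curves with a fixed direction *)

Section Interval.
Context {R : realType}.

(** The mean value theorem on the segment between the two points, which lies in
    [I]; the vanishing derivative is only assumed on [I], so the global
    [is_derive_0_is_cst] does not apply. *)
Lemma is_derive0_cst (I : set R) (f : R -> R) :
  is_interval I -> (forall t, I t -> is_derive t 1 f 0) ->
  forall a b, I a -> I b -> f a = f b.
Proof.
move=> I_itv df; suff le a b : a <= b -> I a -> I b -> f a = f b.
  move=> a b Ia Ib; case/orP: (le_total a b) => ab; first exact: le.
  by apply/esym; exact: le.
move=> ab Ia Ib.
have Iab x : x \in `[a, b] -> I x.
  by rewrite in_itv/= => xab; exact: I_itv xab.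
have dfab x (xab : x \in `]a, b[) := df x (Iab x (subset_itv_oo_cc xab)).
have [|c _] := @MVT_segment _ f (fun=> 0) a b ab dfab.
  by apply: derivable_within_continuous => x /Iab /df [].
by rewrite mul0r => /eqP; rewrite subr_eq0 => /eqP.
Qed.

(** Only the direction of the velocity is constrained, not its size [k t], which
    need not be continuous: no primitive of [k] is taken. Instead a coordinate
    [j] with [v 0 j != 0] provides the affine parameter, because the
    combinations [g_i v_j - g_j v_i] have zero derivative and so freeze every
    other coordinate relative to the [j]-th one. *)
Lemma straight_of_direction n (I : set R) (g : R -> 'rV[R]_n)
    (v : 'rV[R]_n) (k : R -> R) :
  is_interval I -> I !=set0 -> v != 0 ->
  (forall t, I t -> is_derive t 1 g (k t *: v)) -> straight (g @` I).
Proof.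
move=> I_itv [t0 It0] v0 dg.
have dgi t i : I t -> is_derive t 1 (fun s => g s 0 i) (k t * v 0 i).
  by move=> /dg /is_derive_coordP /(_ 0 i); rewrite mxE.
have [j vj] : exists j, v 0 j != 0 by apply/rV0Pn.
pose s t := (g t 0 j - g t0 0 j) / v 0 j.
have gE t : I t -> g t = g t0 + s t *: v.
  move=> It; apply/rowP => i; rewrite !mxE.
  have := @is_derive0_cst I (fun t => g t 0 i * v 0 j - g t 0 j * v 0 i) I_itv.
  move=> /(_ _ t t0 It It0) eq_t; rewrite /s.
  have {}eq_t : g t 0 i * v 0 j - g t 0 j * v 0 i =
      g t0 0 i * v 0 j - g t0 0 j * v 0 i.
    apply: eq_t => u Iu; apply: is_derive_eq.
      apply: is_deriveB; apply: is_derive_mul; exact: dgi.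
    by rewrite mulr0; ring.
  apply: (mulIf vj); rewrite -[LHS](subrK (g t 0 j * v 0 i)) eq_t.
  by field.
exists (g t0), v, (s @` I); split=> //.
- apply/connected_intervalP/connected_continuous_connected.
    exact/connected_intervalP.
  apply/continuous_in_subspaceT => t; rewrite inE => It.
  apply/differentiable_continuous/derivable1_diffP.
  have [] // := is_derive_mul
    (is_deriveB (dgi t j It) (is_derive_cst (g t0 0 j) t 1))
    (is_derive_cst (v 0 j)^-1 t 1).
- by exists (s t0), t0.
- rewrite eqEsubset; split=> [_ [t It <-]|_ [_ [t It <-] <-]].
    by exists (s t); [exists t|rewrite -gE].
  by exists t => //; rewrite gE.
Qed.

End Interval.

(** * Bilinear expressions and their derivatives *)

Section BilinearAlgebra.
Context {R : realType} {n : nat} (C : 'M[R]_n).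
Implicit Types u v w : 'rV[R]_n.

Lemma bilin_linearl a u u' w :
  bilin C (a *: u + u') w = a * bilin C u w + bilin C u' w.
Proof.
rewrite /bilin mulr_sumr -big_split; apply: eq_bigr => i _ /=.
rewrite mulr_sumr -big_split; apply: eq_bigr => j _ /=.
by rewrite !mxE; ring.
Qed.

Lemma bilin0l w : bilin C 0 w = 0.
Proof.
by rewrite /bilin big1// => i _; rewrite big1// => j _; rewrite mxE mulr0 mul0r.
Qed.

Lemma dot_linearr a u u' w : dot w (a *: u + u') = a * dot w u + dot w u'.
Proof.
rewrite /dot mulr_sumr -big_split; apply: eq_bigr => i _ /=.
by rewrite !mxE; ring.
Qed.

Lemma dot0r w : dot w 0 = 0.
Proof. by rewrite /dot big1// => i _; rewrite mxE mulr0. Qed.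

Lemma bilin_sym : (forall i j, C i j = C j i) ->
  forall u w, bilin C u w = bilin C w u.
Proof.
move=> C_sym u w; rewrite /bilin exchange_big; apply: eq_bigr => i _ /=.
by apply: eq_bigr => j _; rewrite C_sym; ring.
Qed.

Context {V : normedModType R}.

Lemma is_derive_bilin (X Y : V -> 'rV[R]_n) (p v : V) X' Y' :
  is_derive p v X X' -> is_derive p v Y Y' ->
  is_derive p v (fun q => bilin C (X q) (Y q))
    (bilin C X' (Y p) + bilin C (X p) Y').
Proof.
move=> /is_derive_coordP dX /is_derive_coordP dY.
rewrite /bilin -big_split; apply: is_derive_sumr => i /=.
rewrite -big_split; apply: is_derive_sumr => j /=.
apply: (is_derive_eq (is_derive_mul
  (is_derive_mul (is_derive_cst (C i j) p v) (dX 0 i)) (dY 0 j))).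
by rewrite /=; ring.
Qed.

Lemma is_derive_dot a (Y : V -> 'rV[R]_n) (p v : V) Y' :
  is_derive p v Y Y' -> is_derive p v (fun q => dot a (Y q)) (dot a Y').
Proof.
move=> /is_derive_coordP dY; exact: is_derive_sumr.
Qed.

End BilinearAlgebra.

(** * The metric tensor *)

Section Metric.
Context {R : realType} {n : nat} (C : 'M[R]_n) (c' : 'rV[R]_n) (c : R).
Context (C_sym : forall i j, C i j = C j i).
Implicit Types u v w x y z e : 'rV[R]_n.
Local Notation h := (hfun C c' c).

(** The differential of [h] at [x], applied to [w]; this form of it uses the
    symmetry of [C]. *)
Definition hdiff x w := 2 * bilin C x w + dot c' w.

(** The Riemannian metric whose squared norm is the radicand: the numerator of
    the latter is [4 h C(y, y) - (dh_x y)^2]. *)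
Definition metric_tensor x y w :=
  bilin C y w / h x - hdiff x y * hdiff x w / (4 * h x ^+ 2).

(** The derivative of [metric_tensor x y w] when [x] moves with velocity
    [x'] while [y] and [w] are fixed. *)
Definition metric_tensor_diff x x' y w :=
  - (bilin C y w * hdiff x x') / h x ^+ 2
  - (bilin C x' y * hdiff x w + hdiff x y * bilin C x' w) / (2 * h x ^+ 2)
  + hdiff x y * hdiff x w * hdiff x x' / (2 * h x ^+ 3).

Lemma metric_tensor_sym x y w : metric_tensor x y w = metric_tensor x w y.
Proof. by rewrite /metric_tensor (bilin_sym C_sym) [hdiff x y * _]mulrC. Qed.

Lemma metric_tensor_linearl x a y y' w :
  metric_tensor x (a *: y + y') w =
  a * metric_tensor x y w + metric_tensor x y' w.
Proof.
rewrite /metric_tensor /hdiff !bilin_linearl.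
rewrite ![bilin C x (_ + _)](bilin_sym C_sym).
by rewrite !bilin_linearl dot_linearr ![bilin C _ x](bilin_sym C_sym); ring.
Qed.

Lemma hdiff0 x : hdiff x 0 = 0.
Proof. by rewrite /hdiff (bilin_sym C_sym) bilin0l dot0r mulr0 addr0. Qed.

Lemma metric_tensor0l x w : metric_tensor x 0 w = 0.
Proof. by rewrite /metric_tensor bilin0l hdiff0 !mul0r subrr. Qed.

Lemma metric_tensor_diff0 x y w : metric_tensor_diff x 0 y w = 0.
Proof. by rewrite /metric_tensor_diff !bilin0l hdiff0; ring. Qed.

Lemma metric_tensor_eq0_basis x y :
  (forall i, metric_tensor x y (delta_mx 0 i) = 0) ->
  forall w, metric_tensor x y w = 0.
Proof.
move=> y0 w; rewrite metric_tensor_sym (row_sum_delta w).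
elim/big_ind : _ => [|u u' u0 u'0|i _].
- exact: metric_tensor0l.
- by rewrite -[u]scale1r metric_tensor_linearl u0 u'0 mulr0 addr0.
- by rewrite -[_ *: _]addr0 metric_tensor_linearl metric_tensor0l addr0
    metric_tensor_sym y0 mulr0.
Qed.

Lemma radicandE x y : h x != 0 -> radicand C c' c x y = metric_tensor x y y.
Proof. by move=> hx; rewrite /radicand /metric_tensor /hdiff; field. Qed.

Context {V : normedModType R}.
Context (p v : V) (X : V -> 'rV[R]_n) (X' : 'rV[R]_n).
Context (dX : is_derive p v X X').

Lemma is_derive_hfun : is_derive p v (fun q => h (X q)) (hdiff (X p) X').
Proof.
apply: (is_derive_eq (is_deriveD
  (is_deriveD (is_derive_bilin C dX dX) (is_derive_dot c' dX))
  (is_derive_cst c p v))).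
by rewrite addr0 (bilin_sym C_sym X') /hdiff; ring.
Qed.

Lemma is_derive_hdiff (Y : V -> 'rV[R]_n) Y' : is_derive p v Y Y' ->
  is_derive p v (fun q => hdiff (X q) (Y q))
    (2 * bilin C X' (Y p) + hdiff (X p) Y').
Proof.
move=> dY; rewrite /hdiff; apply: (is_derive_eq (is_deriveD
  (is_derive_mul (is_derive_cst (2 : R) p v) (is_derive_bilin C dX dY))
  (is_derive_dot c' dY))).
by rewrite /hdiff/=; ring.
Qed.

(** One product rule serves three times below: for the derivatives of the energy
    in [y] and in [x], and for that of the momentum along a geodesic. *)
Lemma is_derive_metric_tensor (Y W : V -> 'rV[R]_n) Y' W' :
  is_derive p v Y Y' -> is_derive p v W W' -> h (X p) != 0 ->
  is_derive p v (fun q => metric_tensor (X q) (Y q) (W q))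
    (metric_tensor_diff (X p) X' (Y p) (W p) +
     metric_tensor (X p) Y' (W p) + metric_tensor (X p) (Y p) W').
Proof.
move=> dY dW hp; have h4 : 4 * h (X p) ^+ 2 != 0.
  by rewrite mulf_neq0 ?expf_neq0 ?pnatr_eq0.
have dh4 : is_derive p v (fun q => 4 * h (X q) ^+ 2)
    (8 * h (X p) * hdiff (X p) X').
  apply: (is_derive_eq (is_derive_mul (is_derive_cst (4 : R) p v)
    (is_derive_mul is_derive_hfun is_derive_hfun))).
  by rewrite /=; ring.
apply: (is_derive_eq (is_deriveB
  (is_derive_div (is_derive_bilin C dY dW) is_derive_hfun hp)
  (is_derive_div (is_derive_mul (is_derive_hdiff dY) (is_derive_hdiff dW))
    dh4 h4))).
by rewrite /metric_tensor_diff /metric_tensor /=; field.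
Qed.

End Metric.

(** * Geodesics *)

Section Geodesics.
Context {R : realType} {n : nat} (C : 'M[R]_n) (c' : 'rV[R]_n) (c : R).
Context (U : set 'rV[R]_n).
Context (C_sym : forall i j, C i j = C j i).
Context (U_open : open U).
Context (h_neq0 : forall x, U x -> hfun C c' c x != 0).
Context (radicand_gt0 : forall x y, U x -> y != 0 -> 0 < radicand C c' c x y).
Implicit Types x y z : 'rV[R]_n.
Local Notation h := (hfun C c' c).
Local Notation dh := (hdiff C c').
Local Notation A := (metric_tensor C c' c).
Local Notation dA := (metric_tensor_diff C c' c).
Local Notation E := (energy (quadratic_metric C c' c)).

(** The square root disappears from the energy; at [y = 0], where the radicand
    is not assumed positive, it is zero. *)
Lemma energyE x y : U x -> E x y = 2^-1 * A x y y.
Proof.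
move=> Ux; rewrite /energy /quadratic_metric -radicandE ?h_neq0//.
rewrite sqr_sqrtr//; have [->|y0] := eqVneq y 0; last exact/ltW/radicand_gt0.
by rewrite radicandE ?h_neq0// (metric_tensor0l c' c C_sym).
Qed.

Lemma partial_energy_y i x y : U x -> partial i (E x) y = A x y (delta_mx 0 i).
Proof.
move=> Ux; rewrite /partial.
have -> : E x = fun y => 2^-1 * A x y y by apply/funext => z; exact: energyE.
set e := delta_mx 0 i; apply: derive_val.
apply: (is_derive_eq (is_derive_mul (is_derive_cst (2^-1 : R) y e)
  (is_derive_metric_tensor C_sym (is_derive_cst x y e) (is_derive_id y e)
    (is_derive_id y e) (h_neq0 Ux)))).
rewrite /= (metric_tensor_sym c' c C_sym x y e).
by rewrite (metric_tensor_diff0 c' c C_sym); field.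
Qed.

Lemma partial_energy_x i x y : U x ->
  partial i (fun x => E x y) x = 2^-1 * dA x (delta_mx 0 i) y y.
Proof.
move=> Ux; rewrite /partial.
set e := delta_mx 0 i; apply: derive_val.
apply: (@near_eq_is_derive _ _ _ (fun x => 2^-1 * A x y y)).
  near=> z; rewrite energyE//; near: z; exact: open_nbhs_nbhs.
apply: (is_derive_eq (is_derive_mul (is_derive_cst (2^-1 : R) x e)
  (is_derive_metric_tensor C_sym (is_derive_id x e) (is_derive_cst y x e)
    (is_derive_cst y x e) (h_neq0 Ux)))).
rewrite /= (metric_tensor_sym c' c C_sym x y 0) (metric_tensor0l c' c C_sym).
by ring.
Unshelve. all: by end_near. Qed.

Context (I : set R) (g : R -> 'rV[R]_n).
Context (g_geo : geodesic U (quadratic_metric C c' c) I g).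
Local Notation g' := (derive1 g).

Lemma geodesic_is_derive t : I t -> is_derive t 1 g (g' t).
Proof.
by move=> /(geodesic_derivable g_geo) dg; rewrite derive1E; exact: derivableP.
Qed.

Lemma geodesic_is_derive2 t : I t -> is_derive t 1 g' (derive1 g' t).
Proof.
by move=> /(geodesic_derivable2 g_geo) dg; rewrite derive1E; exact: derivableP.
Qed.

(** Write [x], [y], [z] for position, velocity and
    acceleration. Once the momentum is differentiated, the Euler-Lagrange
    equation in the direction [e] reads
      [A_x(z, e) = dA(x, e)(y, y) / 2 - dA(x, y)(y, e)],
    where [dA(x, x')] is the derivative of [A] in the direction [x'].
    In the right-hand side the terms in [C(y, y)] cancel, and what is left is
    [(dh y / h) A_x(y, e)]. So [z - (dh y / h) y] is [A_x]-orthogonal to every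
    basis vector, hence to itself, and [A_x] is positive definite. *)
Lemma geodesic_acceleration t : I t ->
  derive1 g' t = (dh (g t) (g' t) / h (g t)) *: g' t.
Proof.
move=> It; have Ug := geodesic_in g_geo It.
set x := g t; set y := g' t; set z := derive1 g' t; set k := _ / _.
apply/eqP; rewrite -subr_eq0 -scaleN1r addrC scalerA mulN1r.
apply: contraT => u0; have := radicand_gt0 Ug u0.
rewrite radicandE ?h_neq0// metric_tensor_eq0_basis ?ltxx// => i.
set e := delta_mx 0 i; rewrite metric_tensor_linearl//.
have EL := geodesic_EL g_geo i It; rewrite partial_energy_x// in EL.
have dp : is_derive t 1 (fun s => A (g s) (g' s) e) (dA x y y e + A x z e).
  apply: (is_derive_eq (is_derive_metric_tensor C_sym (geodesic_is_derive It)
    (geodesic_is_derive2 It) (is_derive_cst e t 1) (h_neq0 Ug))).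
  rewrite (metric_tensor_sym c' c C_sym x y 0) (metric_tensor0l c' c C_sym).
  by rewrite addr0.
(* The momentum is [A] only at points of [U], hence for [s] near [t]. *)
have {}dp : is_derive t 1 (fun s => partial i (E (g s)) (g' s))
    (dA x y y e + A x z e).
  apply: near_eq_is_derive dp; near=> s; rewrite partial_energy_y//.
  apply: (geodesic_in g_geo); near: s.
  by apply: open_nbhs_nbhs; split=> //; exact: (geodesic_open g_geo).
have hx : h x != 0 by exact: h_neq0.
have EL_t := etrans (esym (@derive_val _ _ _ _ _ _ _ dp))
  (@derive_val _ _ _ _ _ _ _ EL).
have -> : A x z e = 2^-1 * dA x e y y - dA x y y e.
  by rewrite -EL_t; ring.
by rewrite /k /metric_tensor_diff /metric_tensor (bilin_sym C_sym y e); field.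
Unshelve. all: by end_near. Qed.

(** By [geodesic_acceleration], [g' / h] has zero derivative, so the velocity is
    [h] times a constant vector. *)
Lemma geodesic_straight : straight (g @` I).
Proof.
have I_itv := geodesic_interval g_geo.
have [t0 It0] := geodesic_nonempty g_geo.
have hg t : I t -> h (g t) != 0 by move=> /(geodesic_in g_geo); exact: h_neq0.
apply: (@straight_of_direction _ _ I g ((h (g t0))^-1 *: g' t0) (h \o g)) => //.
- by exists t0.
- by rewrite scaler_eq0 negb_or invr_eq0 hg// (geodesic_regular g_geo).
move=> t It; apply: (is_derive_eq (geodesic_is_derive It)).
apply/rowP => i; rewrite !mxE/= [_^-1 * _]mulrC.
suff <- : g' t 0 i / h (g t) = g' t0 0 i / h (g t0) by rewrite mulrC divfK ?hg.
apply: (is_derive0_cst I_itv (f := fun s => g' s 0 i / h (g s))) It It0 => s Is.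
have /is_derive_coordP/(_ 0 i) dg' := geodesic_is_derive2 Is.
apply: (is_derive_eq (is_derive_div dg'
  (is_derive_hfun c' c C_sym (geodesic_is_derive Is)) (hg s Is))).
by rewrite geodesic_acceleration// mxE; field; exact: hg.
Qed.

End Geodesics.

Unset Implicit Arguments.

Theorem theorem3p6 (R : realType) (n : nat) (C : 'M[R]_n) (c' : 'rV[R]_n)
    (c : R) (U : set 'rV[R]_n)
    (C_sym : forall i j, C i j = C j i)
    (U_open : open U)
    (h_neq0 : forall x, U x -> hfun C c' c x != 0)
    (radicand_gt0 : forall x y, U x -> y != 0 -> 0 < radicand C c' c x y)
    (F_finsler : finsler_metric U (quadratic_metric C c' c)) :
  finsler_metric U (quadratic_metric C c' c) /\
  projectively_flat U (quadratic_metric C c' c).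
Proof.
by split=> // I g g_geo; exact: (geodesic_straight C_sym U_open h_neq0
  radicand_gt0 g_geo).
Qed.
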